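(* Let $G$ be finite, $q:=\max_vq(v)$, $z\in\mathbb C\setminus\{0\}$, and $\theta\in(0,1)$ with $\theta<|z|/q$. Then every $\mu\in\mathrm{FA}(P)$ with $\mathcal T'\mu=z\mu$ extends (via the pairing on $D_\infty\subseteq\mathrm{Lip}_\theta$) to a continuous linear functional $\ell_\mu$ on $(\mathrm{Lip}_\theta,\|\cdot\|_\theta)$ satisfying $\ell_\mu(\mathcal Tf)=z\,\ell_\mu(f)$ for all $f\in\mathrm{Lip}_\theta$. More precisely, restriction to $D_\infty$ is a linear bijection from $\{\ell\in(\mathrm{Lip}_\theta)':\ \ell\circ\mathcal T_\theta=z\ell\}$ onto $\{\mu\in\mathrm{FA}(P):\mathcal T'\mu=z\mu\}$, where $(\mathrm{Lip}_\theta)'$ is the continuous dual and a functional on $D_\infty$ is identified with the element of $\mathrm{FA}(P)$ inducing it through the pairing.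
   Context: $G$ is a finite connected graph with vertex set $V$ (no loops, no multiple edges, every vertex of degree $\ge2$), $\deg v=1+q(v)$. $E$ oriented edges, $\iota,\tau$, opposite $\bar e$; turn $e\rightsquigarrow e'$ iff $\tau(e)=\iota(e')$, $e'\ne\bar e$. $P$ = infinite paths $(e_1,e_2,\dots)$ with $e_i\rightsquigarrow e_{i+1}$; $(\mathcal Tf)(e_1,\dots)=\sum_{e_0\rightsquigarrow e_1}f(e_0,e_1,\dots)$; $\mathcal T_\theta=\mathcal T|_{\mathrm{Lip}_\theta}$. $D_m$ = functions depending only on $e_1,\dots,e_m$; $D_\infty=\bigcup D_m$. $d_\theta(p,p')=\theta^{k-1}$, $k=\min\{i:e_i\ne e'_i\}$; $\mathrm{Lip}_\theta$ = bounded functions uniformly $d_\theta$-Lipschitz on each island $\{p:\iota(e_1)=v\}$; $\|f\|_\theta=\mathrm L_1(f)+\|f\|_\infty$ with $\mathrm L_1$ the optimal Lipschitz constant over pairs with equal first edge. Postal codes: finite paths $c=(c_1,\dots,c_m)$, $m\ge1$, with $c_i\rightsquigarrow c_{i+1}$; $\mathcal C_m$, $\mathcal C$; $\mathbf 1_c$ indicator of the paths beginning with $c$. $\mathrm{FA}(P)=\{\mu:\mathcal C\to\mathbb C:\mu(c)=\sum_{e:c_m\rightsquigarrow e}\mu(c,e)\}$; pairing $\langle f,\mu\rangle=\sum_{c\in\mathcal C_m}f(c)\mu(c)$ for $f\in D_m$; every linear functional on $D_\infty$ is of the form $\langle\cdot,\mu\rangle$ for a unique $\mu\in\mathrm{FA}(P)$.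 $(\mathcal T'\mu)(c)=\langle\mathcal T\mathbf 1_c,\mu\rangle$. *)

(* Defs.v *)
From mathcomp Require Import all_boot all_order all_algebra.
From mathcomp Require Import boolp classical_sets reals.
From mathcomp Require Import complex.
Import Order.TTheory GRing.Theory Num.Theory.

Set Implicit Arguments.
Unset Strict Implicit.
Unset Printing Implicit Defensive.

Local Open Scope ring_scope.
Local Open Scope classical_set_scope.

Section NonBacktracking.
Variables (R : realType) (V : finType) (adj : rel V).

Definition edge : finType := {x : V * V | adj x.1 x.2}.
Definition src (e : edge) : V := (val e).1.
Definition tgt (e : edge) : V := (val e).2.

Definition turn (e e' : edge) : bool :=
  (tgt e == src e') && ~~ ((src e' == tgt e) && (tgt e' == src e)).

Definition deg (v : V) : nat := #|[set w | adj v w]|.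
Definition qmax : nat := \max_(v : V) (deg v).-1.

(* infinite non-backtracking paths (e_1, e_2, ...) ; index 0 is e_1 *)
Record ipath := IPath { pe :> nat -> edge; pturn : forall i, turn (pe i) (pe i.+1) }.

Definition C := R[i].
Definition nrm (x : C) : R := Normc.normc x.

(* d_theta(p,p') = theta^(k-1), k the first (1-based) index where they differ *)
Definition dtheta (theta : R) (p p' : ipath) : R :=
  match pselect (exists i, p i != p' i) with
  | left h => theta ^+ (ex_minn h)
  | right _ => 0
  end.

Definition bounded_fun (f : ipath -> C) := exists M : R, forall p, nrm (f p) <= M.

Definition Lip (theta : R) (f : ipath -> C) : Prop :=
  bounded_fun f /\
  exists L : R, forall p p' : ipath, src (p 0%N) = src (p' 0%N) ->
      nrm (f p - f p') <= L * dtheta theta p p'.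

Definition L1 (theta : R) (f : ipath -> C) : R :=
  sup [set r : R | exists p p' : ipath,
          [/\ p 0%N = p' 0%N, pe p <> pe p' & r = nrm (f p - f p') / dtheta theta p p']].

Definition supnorm (f : ipath -> C) : R := sup [set nrm (f p) | p in [set: ipath]].

Definition lipnorm (theta : R) (f : ipath -> C) : R := L1 theta f + supnorm f.

Definition pcons (e0 : edge) (p : ipath) (h : turn e0 (p 0%N)) : ipath.
Proof.
refine (@IPath (fun i => if i is i'.+1 then p i' else e0) _).
by case=> [|i] //=; exact: pturn.
Defined.

Definition pextend (e0 : edge) (p : ipath) : ipath :=
  (if turn e0 (p 0%N) as b return turn e0 (p 0%N) = b -> ipath
   then fun h => pcons h else fun _ => p) erefl.

Definition Top (f : ipath -> C) : ipath -> C :=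
  fun p => \sum_(e0 : edge | turn e0 (p 0%N)) f (pextend e0 p).

Definition is_code (c : seq edge) : bool :=
  if c is e :: c' then path turn e c' else false.

Definition prefix (n : nat) (p : ipath) : seq edge := [seq p i | i <- iota 0 n].

Definition ind (c : seq edge) : ipath -> C :=
  fun p => if prefix (size c) p == c then 1 else 0.

Definition inD (m : nat) (f : ipath -> C) : Prop :=
  forall p p' : ipath, (forall i, (i < m)%N -> p i = p' i) -> f p = f p'.

(* f(c) for f in D_m and c in C_m : value of f at some path beginning with c *)
Definition evalc (f : ipath -> C) (c : seq edge) : C :=
  match pselect (exists p : ipath, prefix (size c) p = c) with
  | left h => f (projT1 (cid h))
  | right _ => 0
  end.

Definition pairing (m : nat) (f : ipath -> C) (mu : seq edge -> C) : C :=
  \sum_(t : m.-tuple edge | is_code t) evalc f t * mu t.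

(* finitely additive "measures" FA(P) (values off postal codes irrelevant) *)
Definition FA (mu : seq edge -> C) : Prop :=
  forall e c, path turn e c ->
    mu (e :: c) = \sum_(e' : edge | turn (last e c) e') mu (rcons (e :: c) e').

(* (T' mu)(c) = <T 1_c, mu>  (T 1_c lies in D_m, m = |c|) *)
Definition Tdual (mu : seq edge -> C) (c : seq edge) : C :=
  pairing (size c) (Top (ind c)) mu.

Definition lin_on_Lip (theta : R) (l : (ipath -> C) -> C) : Prop :=
  forall (a : C) f g, Lip theta f -> Lip theta g ->
    l (fun p => a * f p + g p) = a * l f + l g.

Definition cont_on_Lip (theta : R) (l : (ipath -> C) -> C) : Prop :=
  forall f, Lip theta f -> forall eps : R, 0 < eps -> exists2 delta : R, 0 < delta &
    forall g, Lip theta g -> lipnorm theta (fun p => g p - f p) < delta ->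
      nrm (l g - l f) < eps.

Definition eig_functional (theta : R) (z : C) (l : (ipath -> C) -> C) : Prop :=
  [/\ lin_on_Lip theta l, cont_on_Lip theta l &
      forall f, Lip theta f -> l (Top f) = z * l f].

Definition eig_FA (z : C) (mu : seq edge -> C) : Prop :=
  FA mu /\ forall c, is_code c -> Tdual mu c = z * mu c.

Definition extends (l : (ipath -> C) -> C) (mu : seq edge -> C) : Prop :=
  forall m f, (0 < m)%N -> inD m f -> l f = pairing m f mu.

End NonBacktracking.

(* Main.v *)
Require Import Defs.
From mathcomp Require Import all_boot all_order all_algebra.
From mathcomp Require Import boolp classical_sets reals.
From mathcomp Require Import complex.
From mathcomp Require Import ring lra.

(** Write [r = q * theta / |z| < 1].  An eigenfunctional is determined by, and
    can be defined from, the cylinder approximations [cylproj n f] of a Lipschitz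
    function [f], obtained by evaluating [f] at one chosen path for each prefix of
    length [n].  Their sup-norm error is at most [L * theta ^ n], and although they
    need not converge to [f] in the Lipschitz norm, the eigenvalue equation repairs
    this: [l g = z ^ -n * l (T ^ n g)], where [T ^ n] multiplies the sup norm by at
    most [q ^ n] and the Lipschitz constant by at most [(q * theta) ^ n].  Hence
    [l (f - cylproj n f) = O(r ^ n)] for every continuous eigenfunctional, which
    gives injectivity.  Conversely, for an eigen-[mu] the same trick bounds the
    pairing of [mu] with a function of the first [n] edges by
    [M * (q / |z|) ^ (n - 1)] times its sup norm, so the pairings of [mu] with the
    approximations of [f] form a geometrically Cauchy sequence whose limit is the
    required extension.  Since [pairing n f mu] only sees the values of
    [f] at the chosen paths, it equals the pairing of [mu] with [cylproj n f]. *)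

Import Order.TTheory GRing.Theory Num.Theory.
Set Implicit Arguments.
Unset Strict Implicit.
Unset Printing Implicit Defensive.
Local Open Scope ring_scope.

(** * The modulus on the complex numbers *)

Section ComplexModulus.
Variable R : realType.
Implicit Types x y : C R.

Lemma nrm_triangle x y : nrm (x + y) <= nrm x + nrm y.
Proof. exact: le_normcD. Qed.

Lemma nrmN x : nrm (- x) = nrm x.
Proof. exact: normcN. Qed.

Lemma nrmM x y : nrm (x * y) = nrm x * nrm y.
Proof. exact: Normc.normcM. Qed.

Lemma nrm0 : nrm (0 : C R) = 0.
Proof. exact: Normc.normc0. Qed.

Lemma nrm1 : nrm (1 : C R) = 1.
Proof. exact: Normc.normc1. Qed.

Lemma nrm_eq0 x : nrm x = 0 -> x = 0.
Proof. exact: Normc.eq0_normc. Qed.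

Lemma nrm_ge0 x : 0 <= nrm x.
Proof. by case: x => a b; exact: sqrtr_ge0. Qed.

Lemma nrm_distC x y : nrm (x - y) = nrm (y - x).
Proof. by rewrite -nrmN opprB. Qed.

Lemma nrm_sub_triangle y x w : nrm (x - w) <= nrm (x - y) + nrm (y - w).
Proof. by rewrite -{1}(subrKA y x (- w)); exact: nrm_triangle. Qed.

Lemma nrmX x n : nrm (x ^+ n) = nrm x ^+ n.
Proof. by elim: n => [|n IH]; rewrite ?expr0 ?nrm1 // !exprS nrmM IH. Qed.

Lemma nrmV x : nrm x^-1 = (nrm x)^-1.
Proof. exact: Normc.normcV. Qed.

Lemma nrm_sum (I : finType) (P : pred I) (F : I -> C R) :
  nrm (\sum_(i | P i) F i) <= \sum_(i | P i) nrm (F i).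
Proof.
elim/big_ind2: _ => [|x1 x2 y1 y2 h1 h2|//]; first by rewrite nrm0.
exact: le_trans (nrm_triangle _ _) (lerD h1 h2).
Qed.

Lemma Re_le_nrm x : `|complex.Re x| <= nrm x.
Proof.
by case: x => a b /=; rewrite -sqrtr_sqr ler_wsqrtr // lerDl sqr_ge0.
Qed.

Lemma Im_le_nrm x : `|complex.Im x| <= nrm x.
Proof.
by case: x => a b /=; rewrite -sqrtr_sqr ler_wsqrtr // lerDr sqr_ge0.
Qed.

Lemma nrm_le_ReIm x : nrm x <= `|complex.Re x| + `|complex.Im x|.
Proof.
case: x => a b /=; rewrite -[leRHS]ger0_norm ?addr_ge0 //.
rewrite -sqrtr_sqr ler_wsqrtr //.
have := real_normK (num_real a); have := real_normK (num_real b).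
have := normr_ge0 a; have := normr_ge0 b.
nra.
Qed.

End ComplexModulus.

(** * Geometric decay and geometrically Cauchy sequences *)

Section GeometricConvergence.
Context (R : realType) (r : R) (r_ge0 : 0 <= r) (r_lt1 : r < 1).

Lemma expr_small (eps : R) : 0 < eps ->
  exists N, forall n, (N <= n)%N -> r ^+ n < eps.
Proof.
move=> eps_gt0; pose s := 1 - r.
have s_gt0 : 0 < s by rewrite subr_gt0.
(* Bernoulli's inequality in product form: [r * (1 + (n + 1) * s)] falls short of [1 + n * s] by
   exactly [(n + 1) * s ^+ 2]. *)
have bern n : r ^+ n * (1 + n%:R * s) <= 1.
  elim: n => [|n IH]; first by rewrite expr0 mul0r addr0 mulr1.
  apply: le_trans IH; rewrite exprSr -mulrA ler_wpM2l ?exprn_ge0 //.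
  have : 0 <= n.+1%:R * s ^+ 2 by rewrite mulr_ge0 ?sqr_ge0.
  by rewrite -natr1 /s expr2; lra.
exists (Num.bound (eps^-1 / s)) => n le_n.
have h : eps^-1 / s < n%:R.
  apply: lt_le_trans (archi_boundP _) _; rewrite ?ler_nat //.
  by rewrite divr_ge0 ?invr_ge0 ?ltW.
rewrite ltr_pdivrMr // in h.
have h2 : 1 < eps * (1 + n%:R * s).
  have : eps * eps^-1 = 1 by rewrite divff ?gt_eqF.
  move: h; set a := n%:R * s; set b := eps^-1; nra.
have pos : 0 < 1 + n%:R * s by rewrite ltr_pwDl // mulr_ge0 // ltW.
rewrite -(ltr_pM2r pos); exact: le_lt_trans (bern n) h2.
Qed.

Lemma geometric_eq0 (x : C R) (K : R) (N : nat) :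
  (forall n, (N <= n)%N -> nrm x <= K * r ^+ n) -> x = 0.
Proof.
move=> h; apply: nrm_eq0; apply/eqP; rewrite eq_le nrm_ge0 andbT leNgt.
apply/negP => x_gt0.
have K1 : 0 < `|K| + 1 by rewrite ltr_wpDl.
have [N' hN'] := @expr_small (nrm x / (`|K| + 1)) (divr_gt0 x_gt0 K1).
have := hN' _ (leq_maxr N N'); have := h _ (leq_maxl N N').
set t := r ^+ _; have t0 : 0 <= t by rewrite exprn_ge0.
rewrite ltr_pdivlMr //.
have := ler_norm K; nra.
Qed.

(** The intervals of radius [K / (1 - r) * r ^+ n] around [u n] are nested, since consecutive radii
    differ by exactly [K * r ^+ n]. The supremum of their left ends lies in all of them. *)
Lemma geometric_cauchy_real (u : nat -> R) (K : R) :
  (forall n, `|u n.+1 - u n| <= K * r ^+ n) ->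
  exists l, forall n, `|l - u n| <= K / (1 - r) * r ^+ n.
Proof.
move=> hu; pose c n := K / (1 - r) * r ^+ n.
have cS n : K * r ^+ n = c n - c n.+1.
  rewrite /c exprS; field; move: r_lt1; lra.
have K_ge0 : 0 <= K by have := le_trans (normr_ge0 _) (hu 0%N); rewrite expr0 mulr1.
have c_ge0 n : 0 <= c n.
  by rewrite mulr_ge0 ?exprn_ge0 // divr_ge0 // subr_ge0 ltW.
have lowS n : u n - c n <= u n.+1 - c n.+1.
  by have := hu n; rewrite cS ler_norml => /andP[]; lra.
have upS n : u n.+1 + c n.+1 <= u n + c n.
  by have := hu n; rewrite cS ler_norml => /andP[]; lra.
have low m n : (m <= n)%N -> u m - c m <= u n - c n.
  move=> /subnK <-; elim: (n - m)%N => // k IH; exact: le_trans IH (lowS _).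
have up m n : (m <= n)%N -> u n + c n <= u m + c m.
  move=> /subnK <-; elim: (n - m)%N => // k IH; exact: le_trans (upS _) IH.
have lowup m n : u m - c m <= u n + c n.
  have := low _ _ (leq_maxl m n); have := up _ _ (leq_maxr m n).
  by have := c_ge0 (maxn m n); lra.
pose E := [set u m - c m | m in [set: nat]]%classic.
have E0 : (E !=set0)%classic by exists (u 0%N - c 0%N); exists 0%N.
have Eub n : ubound E (u n + c n) by move=> _ [m _ <-].
exists (sup E) => n; rewrite ler_norml; apply/andP; split.
  rewrite lerBrDr addrC; apply: sup_upper_bound; last by exists n.
  by split=> //; exists (u 0%N + c 0%N); exact: Eub.
by rewrite lerBlDr addrC; exact: ge_sup.
Qed.

Lemma geometric_cauchy (u : nat -> C R) (K : R) :
  (forall n, nrm (u n.+1 - u n) <= K * r ^+ n) ->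
  exists l, forall n, nrm (l - u n) <= 2 * (K / (1 - r)) * r ^+ n.
Proof.
move=> hu.
have [|a ha] := @geometric_cauchy_real (fun n => complex.Re (u n)) K.
  by move=> n; rewrite -raddfB; exact: le_trans (Re_le_nrm _) (hu n).
have [|b hb] := @geometric_cauchy_real (fun n => complex.Im (u n)) K.
  by move=> n; rewrite -raddfB; exact: le_trans (Im_le_nrm _) (hu n).
(* The factor 2 in the bound comes from adding the errors of the real and imaginary parts. *)
exists (a +i* b)%C => n; apply: le_trans (nrm_le_ReIm _) _.
rewrite !raddfB /=; have := lerD (ha n) (hb n); lra.
Qed.

End GeometricConvergence.

(** * Agreement of paths and the Lipschitz norm *)

Section Paths.
Context (R : realType) (V : finType) (adj : rel V).
Implicit Types (p : ipath adj) (f g : ipath adj -> C R) (c : seq (edge adj))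
  (mu : seq (edge adj) -> C R).

(* [prefix] alone would denote the list predicate [seq.prefix]. *)
Local Notation prefix := Defs.prefix.

Definition agree k p p' := forall i, (i < k)%N -> p i = p' i.

Lemma agreeW k m p p' : (m <= k)%N -> agree k p p' -> agree m p p'.
Proof. by move=> le_mk h i hi; apply: h; exact: leq_trans hi le_mk. Qed.

Lemma agree_sym k p p' : agree k p p' -> agree k p' p.
Proof. by move=> h i /h. Qed.

Lemma agree_trans k p' p p'' : agree k p p' -> agree k p' p'' -> agree k p p''.
Proof. by move=> h h' i hi; rewrite h ?h'. Qed.

Lemma size_prefix n p : size (prefix n p) = n.
Proof. by rewrite size_map size_iota. Qed.

Lemma nth_prefix e n p i : (i < n)%N -> nth e (prefix n p) i = p i.
Proof. by move=> hi; rewrite (nth_map 0%N) ?size_iota // nth_iota. Qed.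

Lemma prefixP n p p' : prefix n p = prefix n p' <-> agree n p p'.
Proof.
split=> [h i hi|h].
  by rewrite -(nth_prefix (p 0%N) p hi) h nth_prefix.
by apply/eq_in_map => i; rewrite mem_iota => /andP[_]; exact: h.
Qed.

Lemma prefixS n p : prefix n.+1 p = rcons (prefix n p) (p n).
Proof. by rewrite /prefix -addn1 iotaD map_cat cats1. Qed.

Lemma prefix_code n p : is_code (prefix n.+1 p).
Proof.
apply/(pathP (p 0%N)) => i; rewrite size_map size_iota => hi.
rewrite -[_ :: _]/(prefix n.+1 p) nth_prefix ?(leqW hi) //.
by rewrite (nth_map 0%N) ?size_iota // nth_iota //; exact: pturn.
Qed.

Lemma ipath_eq p p' : pe p =1 pe p' -> p = p'.
Proof.
case: p p' => [u hu] [v hv] /= /funext E; case: v / E hv => hv.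
by congr IPath; apply: Prop_irrelevance.
Qed.

Lemma dtheta_ge0 (theta : R) p p' : 0 < theta -> 0 <= dtheta theta p p'.
Proof. by move=> t0; rewrite /dtheta; case: pselect => // h; rewrite exprn_ge0 ?ltW. Qed.

Lemma dtheta_gt0 (theta : R) p p' : 0 < theta -> pe p <> pe p' -> 0 < dtheta theta p p'.
Proof.
move=> t0 ne; rewrite /dtheta; case: pselect => [h|[]]; first exact: exprn_gt0.
apply: contrapT => h; apply: ne; apply: funext => i.
by apply/eqP/negP => /negP hi; apply: h; exists i.
Qed.

Lemma dtheta_agree (theta : R) k p p' :
  0 < theta < 1 -> agree k p p' -> dtheta theta p p' <= theta ^+ k.
Proof.
move=> /andP[t0 t1] h; rewrite /dtheta; case: pselect => [ex|_]; last first.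
  by rewrite exprn_ge0 // ltW.
case: ex_minnP => m hm _; apply: ler_wiXn2l; rewrite ?ltW //.
by case: leqP => // /h /eqP; rewrite (negbTE hm).
Qed.

Lemma dtheta_exists (theta : R) p p' : pe p <> pe p' -> exists k,
  [/\ agree k p p', dtheta theta p p' = theta ^+ k & p 0%N = p' 0%N -> (0 < k)%N].
Proof.
move=> ne; rewrite /dtheta; case: pselect => [ex|h]; last first.
  case: ne; apply: funext => i.
  by apply/eqP/negP => /negP hi; apply: h; exists i.
case: ex_minnP => m hm hmin; exists m; split=> //.
  move=> i hi; apply/eqP/negP => /negP /hmin; by rewrite leqNgt hi.
by move=> E; case: m hm {hmin} => //; rewrite E eqxx.
Qed.

(** Agreement lengths replace [dtheta], so that prefix arguments apply directly; [0 < k] restricts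
    to pairs with equal first edge, as in [L1]. *)
Definition lipbound (theta L : R) f :=
  forall k p p', (0 < k)%N -> agree k p p' -> nrm (f p - f p') <= L * theta ^+ k.

Definition supbound (B : R) f := forall p, nrm (f p) <= B.

Section LipNorm.
Context (theta : R) (theta_gt0 : 0 < theta) (theta_lt1 : theta < 1).

Let t01 : 0 < theta < 1. Proof. exact/andP. Qed.

(** [Lip] also compares paths leaving one vertex along different edges. Those are at distance 1,
    where the sup bound alone gives the constant [B + B]. *)
Lemma Lip_intro (B L : R) f : supbound B f -> lipbound theta L f -> Lip theta f.
Proof.
move=> hB hL; split; first by exists B.
exists (Num.max (Num.max L 0) (B + B)) => p p' _; set M := Num.max _ _.
have [E|/eqP ne] := pselect (pe p = pe p').
  have -> : p = p' by apply: ipath_eq; rewrite E.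
  by rewrite subrr nrm0 mulr_ge0 ?dtheta_ge0 // /M !le_max lexx orbT.
have [[|k] [hk -> _]] := dtheta_exists theta (elimN eqP ne).
  rewrite expr0 mulr1; apply: (le_trans (nrm_triangle _ _)).
  by rewrite nrmN /M le_max (lerD (hB p) (hB p')) orbT.
apply: le_trans (hL _ _ _ _ hk) _ => //.
by rewrite ler_wpM2r ?exprn_ge0 ?(ltW theta_gt0) // /M !le_max lexx.
Qed.

Lemma Lip_elim f : Lip theta f ->
  exists B L : R, [/\ 0 <= B, 0 <= L, supbound B f & lipbound theta L f].
Proof.
move=> [[B hB] [L hL]]; exists (Num.max B 0), (Num.max L 0).
split; rewrite ?le_max ?lexx ?orbT //.
  by move=> p; rewrite le_max hB.
move=> k p p' k0 h.
apply: le_trans (hL _ _ _) _; first by rewrite (h 0%N k0).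
apply: (@le_trans _ _ (Num.max L 0 * dtheta theta p p')).
  by rewrite ler_wpM2r ?dtheta_ge0 // le_max lexx.
by rewrite ler_wpM2l ?dtheta_agree // le_max lexx orbT.
Qed.

Lemma supnorm_bound f : bounded_fun f -> supbound (supnorm f) f.
Proof.
move=> [B hB] p; apply: sup_upper_bound; last by exists p.
by split; [exists (nrm (f p)), p | exists B => _ [p' _ <-]].
Qed.

Lemma supnorm_le (B : R) f : 0 <= B -> supbound B f -> supnorm f <= B.
Proof.
move=> B0 hB; rewrite /supnorm; set E := (X in sup X).
have [E0|/set0P E0] := eqVneq E set0; first by rewrite E0 sup0.
by apply: ge_sup => // _ [p _ <-].
Qed.

Lemma lipbound_quotient (L : R) f p p' : lipbound theta L f -> p 0%N = p' 0%N ->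
  pe p <> pe p' -> nrm (f p - f p') / dtheta theta p p' <= L.
Proof.
move=> hL h0 ne; rewrite ler_pdivrMr ?dtheta_gt0 //.
have [k [hk -> k0]] := dtheta_exists theta ne.
by apply: hL => //; exact: k0.
Qed.

Lemma L1_le (L : R) f : 0 <= L -> lipbound theta L f -> L1 theta f <= L.
Proof.
move=> L0 hL; rewrite /L1; set E := (X in sup X).
(* The set is empty, for instance, on a cycle graph, where the first edge determines the path; [sup]
   then takes the value 0, whence [0 <= L]. *)
have [E0|/set0P E0] := eqVneq E set0; first by rewrite E0 sup0.
by apply: ge_sup => // _ [p [p' [h0 ne ->]]]; exact: lipbound_quotient.
Qed.

Lemma quotient_le_L1 f p p' : Lip theta f -> p 0%N = p' 0%N -> pe p <> pe p' ->
  nrm (f p - f p') / dtheta theta p p' <= L1 theta f.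
Proof.
move=> hf h0 ne; apply: sup_upper_bound; last by exists p, p'.
split; first by exists (nrm (f p - f p') / dtheta theta p p'), p, p'.
have [B [L [_ _ _ hL]]] := Lip_elim hf.
by exists L => _ [a [b [hab nab ->]]]; exact: lipbound_quotient.
Qed.

Lemma L1_ge0 f : Lip theta f -> 0 <= L1 theta f.
Proof.
move=> hf; rewrite /L1; set E := (X in sup X).
have [->|/set0P [_ [p [p' [h0 ne _]]]]] := eqVneq E set0; first by rewrite sup0.
apply: le_trans (quotient_le_L1 hf h0 ne).
by rewrite divr_ge0 ?nrm_ge0 ?dtheta_ge0.
Qed.

Lemma L1_bound f : Lip theta f -> lipbound theta (L1 theta f) f.
Proof.
move=> hf k p p' k0 h.
have [E|ne] := pselect (pe p = pe p').
  have -> : p = p' by apply: ipath_eq; rewrite E.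
  by rewrite subrr nrm0 mulr_ge0 ?L1_ge0 ?exprn_ge0 ?(ltW theta_gt0).
have := quotient_le_L1 hf (h 0%N k0) ne.
rewrite ler_pdivrMr ?dtheta_gt0 // => /le_trans; apply.
by rewrite ler_wpM2l ?L1_ge0 ?dtheta_agree.
Qed.

Lemma lipnorm_le (B L : R) f : 0 <= B -> 0 <= L -> supbound B f ->
  lipbound theta L f -> lipnorm theta f <= L + B.
Proof. by move=> B0 L0 hB hL; rewrite lerD ?L1_le ?supnorm_le. Qed.

Lemma supbound_lin (a : C R) (B B' : R) f g : supbound B f -> supbound B' g ->
  supbound (nrm a * B + B') (fun p => a * f p + g p).
Proof.
move=> hf hg p; apply: le_trans (nrm_triangle _ _) _.
by rewrite nrmM lerD ?ler_wpM2l ?nrm_ge0.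
Qed.

Lemma lipbound_lin (a : C R) (L L' : R) f g : lipbound theta L f ->
  lipbound theta L' g -> lipbound theta (nrm a * L + L') (fun p => a * f p + g p).
Proof.
move=> hf hg k p p' k0 h.
have -> : a * f p + g p - (a * f p' + g p') = a * (f p - f p') + (g p - g p').
  by ring.
apply: le_trans (nrm_triangle _ _) _.
rewrite nrmM mulrDl -mulrA lerD ?hg // ler_wpM2l ?nrm_ge0 //; exact: hf.
Qed.

Lemma Lip_lin (a : C R) f g : Lip theta f -> Lip theta g ->
  Lip theta (fun p => a * f p + g p).
Proof.
move=> /Lip_elim[B [L [_ _ hB hL]]] /Lip_elim[B' [L' [_ _ hB' hL']]].
exact: Lip_intro (supbound_lin a hB hB') (lipbound_lin a hL hL').
Qed.

End LipNorm.

End Paths.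

(** * The transfer operator, cylinder approximations and the pairing *)

Section TransferOperator.
Context (R : realType) (V : finType) (adj : rel V).
Implicit Types (p : ipath adj) (f g : ipath adj -> C R) (c : seq (edge adj))
  (mu : seq (edge adj) -> C R) (e : edge adj).

Local Notation prefix := Defs.prefix.
Local Notation q := ((qmax adj)%:R : R).

Lemma pextend_cons e p (h : turn e (p 0%N)) : pextend e p = pcons h.
Proof.
rewrite /pextend; move: (erefl (turn e (p 0%N))).
case: {2 3}(turn e (p 0%N)) => h'; last by rewrite h in h'.
by apply: ipath_eq.
Qed.

Lemma prefix_pcons n e p (h : turn e (p 0%N)) :
  prefix n.+1 (pcons h) = e :: prefix n p.
Proof. by rewrite /prefix /= (iotaDl 1 0) -map_comp. Qed.

Lemma agree_pextend k e p p' : turn e (p 0%N) -> (0 < k)%N -> agree k p p' ->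
  agree k.+1 (pextend e p) (pextend e p').
Proof.
move=> h k0 hk; have h' : turn e (p' 0%N) by rewrite -hk.
by rewrite (pextend_cons h) (pextend_cons h') => -[|i] //= /hk.
Qed.

Lemma deg_card v : deg adj v = #|[pred w | adj v w]|.
Proof. by apply: eq_card => w; rewrite !inE; apply/asboolP/idP. Qed.

(** A predecessor of [e] is determined by its source, which is a neighbour of [src e] other than
    [tgt e]. *)
Lemma card_turn e : symmetric adj -> (#|[pred e0 | turn e0 e]| <= qmax adj)%N.
Proof.
move=> adj_sym; apply: leq_trans (leq_bigmax (src e)); rewrite deg_card.
have e_adj : tgt e \in [pred w | adj (src e) w] by exact: valP e.
rewrite (cardD1 (tgt e)) e_adj add1n /=.
have src_inj : {in [pred e0 | turn e0 e] &, injective (@src V adj)}.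
  move=> e1 e2; rewrite !inE => /andP[/eqP E1 _] /andP[/eqP E2 _] E.
  apply: val_inj; move: E1 E2 E; rewrite /src /tgt.
  by case: (val e1) => ? ? /=; case: (val e2) => ? ? /= -> -> ->.
rewrite -(card_in_image src_inj).
apply: subset_leq_card; apply/fintype.subsetP => w /fintype.imageP[e0].
rewrite !inE => /andP[/eqP E]; rewrite E eqxx /= => ne ->.
by rewrite eq_sym ne adj_sym -E; exact: valP e0.
Qed.

Lemma Top_lin (a : C R) f g :
  Top (fun p => a * f p + g p) = (fun p => a * Top f p + Top g p).
Proof. by apply: funext => p; rewrite /Top big_split mulr_sumr. Qed.

Lemma sum_turn_le e (B : R) (F : edge adj -> C R) : symmetric adj -> 0 <= B ->
  (forall e0, turn e0 e -> nrm (F e0) <= B) ->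
  nrm (\sum_(e0 | turn e0 e) F e0) <= q * B.
Proof.
move=> adj_sym B0 hF; apply: le_trans (nrm_sum _ _) _.
apply: le_trans (ler_sum _ hF) _.
by rewrite sumr_const -[leLHS]mulr_natl ler_wpM2r // ler_nat card_turn.
Qed.

Lemma Top_supbound (B : R) f : symmetric adj -> 0 <= B -> supbound B f ->
  supbound (q * B) (Top f).
Proof. by move=> adj_sym B0 hB p; apply: sum_turn_le. Qed.

(** Both paths have the same predecessors, and prepending a common edge lengthens the agreement by
    one, which gains the factor [theta]. *)
Lemma Top_lipbound (theta L : R) f : symmetric adj -> 0 < theta -> 0 <= L ->
  lipbound theta L f -> lipbound theta (q * theta * L) (Top f).
Proof.
move=> adj_sym t0 L0 hL k p p' k0 h.
rewrite /Top -(h 0%N k0) -sumrB.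
have -> : q * theta * L * theta ^+ k = q * (L * theta ^+ k.+1).
  by rewrite exprS (mulrCA L) !mulrA.
apply: sum_turn_le => // [|e0 he0]; first by rewrite mulr_ge0 ?exprn_ge0 ?(ltW t0).
by apply: hL => //; exact: agree_pextend.
Qed.

Lemma inDW m n f : (m <= n)%N -> inD m f -> inD n f.
Proof. by move=> le_mn h p p' hp; apply: h => i hi; apply: hp; exact: leq_trans hi le_mn. Qed.

(** [Top] fills the first slot and so removes one edge of dependence, but never the last one: the
    first edge decides which predecessors occur in the sum. *)
Lemma Top_inD m f : inD m.+2 f -> inD m.+1 (Top f).
Proof.
move=> hf p p' h; rewrite /Top -(h 0%N isT); apply: eq_bigr => e0 he0.
by apply: hf; exact: agree_pextend.
Qed.

Lemma ind_inD c : inD (size c) (ind R c).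
Proof. by move=> p p' h; rewrite /ind (prefixP _ p p').2. Qed.

Lemma evalc_lin (a : C R) f g c :
  evalc (fun p => a * f p + g p) c = a * evalc f c + evalc g c.
Proof. by rewrite /evalc; case: pselect => //; rewrite mulr0 addr0. Qed.

Lemma evalc_witness c p : Defs.prefix (size c) p = c ->
  exists2 p', Defs.prefix (size c) p' = c & forall f, evalc f c = f p'.
Proof.
move=> h; rewrite /evalc; case: pselect => [ex|]; last by case; exists p.
by case: (cid ex) => p' h' /=; exists p'.
Qed.

Lemma evalc_path f c p : inD (size c) f -> prefix (size c) p = c -> evalc f c = f p.
Proof.
move=> hf h; have [p' h' ->] := evalc_witness h.
by apply: hf; apply/prefixP; rewrite h h'.
Qed.

Lemma evalc_bound (B : R) f c : 0 <= B -> supbound B f -> nrm (evalc f c) <= B.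
Proof. by move=> B0 hB; rewrite /evalc; case: pselect => [h|_]; rewrite ?nrm0. Qed.

Definition cylproj n f : ipath adj -> C R := fun p => evalc f (prefix n p).

Lemma cylproj_witness n p :
  exists2 p', agree n p p' & forall f, cylproj n f p = f p'.
Proof.
have h : prefix (size (prefix n p)) p = prefix n p by rewrite size_prefix.
have [p' h' E] := evalc_witness h; exists p' => //.
by apply/prefixP; rewrite size_prefix in h'.
Qed.

Lemma cylproj_inD n f : inD n (cylproj n f).
Proof. by move=> p p' /prefixP h; rewrite /cylproj h. Qed.

Lemma cylproj_id n f p : inD n f -> cylproj n f p = f p.
Proof. by move=> hf; have [p' h ->] := cylproj_witness n p; apply/hf/agree_sym. Qed.

Lemma evalc_cylproj f c : evalc (cylproj (size c) f) c = evalc f c.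
Proof.
have [[p h]|h] := pselect (exists p, prefix (size c) p = c).
  by rewrite (evalc_path (@cylproj_inD _ _) h) /cylproj h.
by rewrite /evalc; case: pselect.
Qed.

Lemma cylproj_supbound n (B : R) f : supbound B f -> supbound B (cylproj n f).
Proof. by move=> hB p; have [p' _ ->] := cylproj_witness n p. Qed.

(** The constant does not grow: at agreement [n] or more the values coincide, and below [n] the
    chosen representatives agree as far as [p] and [p'] do. *)
Lemma cylproj_lipbound n (theta L : R) f : 0 < theta -> 0 <= L ->
  lipbound theta L f -> lipbound theta L (cylproj n f).
Proof.
move=> t0 L0 hL k p p' k0 h.
have [le_nk|lt_kn] := leqP n k.
  rewrite (@cylproj_inD n f p p' (agreeW le_nk h)) subrr nrm0.
  by rewrite mulr_ge0 ?exprn_ge0 ?(ltW t0).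
have [p1 h1 ->] := cylproj_witness n p; have [p2 h2 ->] := cylproj_witness n p'.
apply: hL => //; have le := ltnW lt_kn.
apply: agree_trans (agreeW le (agree_sym h1)) _.
exact: agree_trans h (agreeW le h2).
Qed.

Lemma cylproj_dist n (theta L : R) f : (0 < n)%N -> lipbound theta L f ->
  supbound (L * theta ^+ n) (fun p => -1 * cylproj n f p + f p).
Proof.
move=> n0 hL p; have [p' h ->] := cylproj_witness n p.
by rewrite mulN1r addrC; exact: hL.
Qed.

Lemma inD_supbound m f : inD m f -> exists2 B : R, 0 <= B & supbound B f.
Proof.
move=> hf; exists (\sum_(t : m.-tuple (edge adj)) nrm (evalc f t)).
  by apply: sumr_ge0 => t _; exact: nrm_ge0.
move=> p; rewrite -(cylproj_id p hf) /cylproj.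
have hs : size (prefix m p) == m by rewrite size_prefix.
rewrite (bigD1 (Tuple hs)) //= lerDl; apply: sumr_ge0 => t _; exact: nrm_ge0.
Qed.

Lemma inD_Lip (theta : R) m f : 0 < theta -> theta < 1 -> inD m f -> Lip theta f.
Proof.
move=> t0 t1 hf; have [B B0 hB] := inD_supbound hf.
(* Only agreements [k < m] cost anything; there the difference is at most [B + B], and [theta ^+ k]
   is at least [theta ^+ m]. *)
apply: (@Lip_intro _ _ _ theta t0 B ((B + B) / theta ^+ m)) => // k p p' k0 h.
have tm k' : 0 < theta ^+ k' by exact: exprn_gt0.
have [le_mk|lt_km] := leqP m k.
  rewrite (hf p p' (agreeW le_mk h)) subrr nrm0.
  by rewrite mulr_ge0 ?divr_ge0 ?addr_ge0 // ltW.
apply: (@le_trans _ _ (B + B)).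
  by apply: le_trans (nrm_triangle _ _) _; rewrite nrmN lerD.
rewrite -mulrA ler_peMr ?addr_ge0 // mulrC ler_pdivlMr // mul1r.
exact: (ler_wiXn2l (ltW t0) (ltW t1) (ltnW lt_km)).
Qed.

Lemma ind_Lip (theta : R) c : 0 < theta -> theta < 1 -> Lip theta (ind R c).
Proof. by move=> t0 t1; exact: inD_Lip (@ind_inD c). Qed.

Lemma inD_expand m f : inD m.+1 f ->
  f = (fun p => \sum_(t : m.+1.-tuple (edge adj) | is_code t) evalc f t * ind R t p).
Proof.
move=> hf; apply: funext => p.
have hs : size (prefix m.+1 p) == m.+1 by rewrite size_prefix.
rewrite (bigD1 (Tuple hs)) ?prefix_code //= big1 => [|t /andP[_ ne]].
  rewrite /ind size_prefix eqxx mulr1 addr0; exact/esym/cylproj_id.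
rewrite /ind size_tuple; case: eqP => [E|_]; last by rewrite mulr0.
by case/eqP: ne; apply: val_inj; rewrite /= -E.
Qed.

Lemma lin_on_Lip0 (theta : R) (l : (ipath adj -> C R) -> C R) :
  0 < theta -> theta < 1 -> lin_on_Lip theta l -> l (fun=> 0) = 0.
Proof.
move=> t0 t1 hl; have h0 : Lip theta (fun _ : ipath adj => 0 : C R) by apply: (@inD_Lip _ 0).
have := hl 1 _ _ h0 h0; have -> : (fun _ : ipath adj => 1 * 0 + 0 : C R) = fun=> 0.
  by apply: funext => p; rewrite mulr0 addr0.
by rewrite mul1r => /eqP; rewrite -subr_eq subrr eq_sym => /eqP.
Qed.

(** Both claims share one induction, because linearity of [l] applies only to functions already
    known to be Lipschitz. *)
Lemma lin_on_Lip_sum (theta : R) (l : (ipath adj -> C R) -> C R)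
  (I : Type) (s : seq I) (P : pred I) (a : I -> C R) (F : I -> ipath adj -> C R) :
  0 < theta -> theta < 1 -> lin_on_Lip theta l -> (forall i, Lip theta (F i)) ->
  Lip theta (fun p => \sum_(i <- s | P i) a i * F i p) /\
  l (fun p => \sum_(i <- s | P i) a i * F i p) = \sum_(i <- s | P i) a i * l (F i).
Proof.
move=> t0 t1 hl hF; elim: s => [|i s [IH1 IH2]].
  under [X in Lip _ X]funext do rewrite big_nil.
  under [X in l X]funext do rewrite big_nil.
  rewrite big_nil (lin_on_Lip0 t0 t1 hl); split=> //; exact: (@inD_Lip _ 0).
under [X in Lip _ X]funext do rewrite big_cons.
under [X in l X]funext do rewrite big_cons.
rewrite big_cons; case: (P i) => //; split; first exact: Lip_lin.
by rewrite hl // IH2.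
Qed.

Lemma lin_on_Lip_inD (theta : R) (l : (ipath adj -> C R) -> C R) m f :
  0 < theta -> theta < 1 -> lin_on_Lip theta l -> inD m.+1 f ->
  l f = pairing m.+1 f (fun c => l (ind R c)).
Proof.
move=> t0 t1 hl hf; rewrite {1}(inD_expand hf).
apply: (proj2 (lin_on_Lip_sum _ _ _ t0 t1 hl _)) => t; exact: ind_Lip.
Qed.

Lemma pairing_lin m (a : C R) f g mu :
  pairing m (fun p => a * f p + g p) mu = a * pairing m f mu + pairing m g mu.
Proof.
rewrite /pairing mulr_sumr -big_split /=; apply: eq_bigr => t _.
by rewrite evalc_lin mulrDl mulrA.
Qed.

Lemma pairing_cylproj m f mu : pairing m (cylproj m f) mu = pairing m f mu.
Proof.
apply: eq_bigr => t _; have := evalc_cylproj f t.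
by rewrite size_tuple => ->.
Qed.

(** The hypothesis on [mu] is the case of indicators, and these span the functions of [m.+1]
    edges. *)
Lemma pairing_Top m f (z : C R) mu : eig_FA z mu -> inD m.+1 f ->
  pairing m.+1 (Top f) mu = z * pairing m.+1 f mu.
Proof.
move=> [_ hmu] hf.
(* Linearity is only used on cylinder functions, so any exponent in (0, 1) will do. *)
have half : 0 < 2^-1 :> R /\ 2^-1 < 1 :> R by split; lra.
have hl : lin_on_Lip 2^-1 (fun f => pairing m.+1 (Top f) mu).
  by move=> a f1 f2 _ _; rewrite Top_lin pairing_lin.
rewrite (lin_on_Lip_inD half.1 half.2 hl hf) /pairing mulr_sumr.
apply: eq_bigr => t ht; rewrite mulrCA; congr (_ * _).
by rewrite -hmu // /Tdual size_tuple.
Qed.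

(** * Non-empty cylinders, change of depth, and growth of the pairing *)

Section Extension.
Context (deg_ge2 : forall v : V, (2 <= deg adj v)%N).

Lemma exists_turn e : exists e', turn e e'.
Proof.
have := deg_ge2 (tgt e); rewrite deg_card (cardD1 (src e)) => h.
have : (0 < #|[predD1 [pred w | adj (tgt e) w] & src e]|)%N.
  by move: h; case: (_ \in _) => //= /ltnW.
case/card_gt0P => w; rewrite !inE => /andP[ne hw].
by exists (Sub (tgt e, w) hw : edge adj); rewrite /turn /src /tgt /= eqxx (negbTE ne).
Qed.

(** Degree at least 2 lets every path continue without backtracking. Hence [evalc] never takes its
    default value 0 at a code. *)
Lemma code_realized c : is_code c -> exists p : ipath adj, prefix (size c) p = c.
Proof.
case: c => // e c; elim: c e => [|e' c IH] e /=.
  pose next x := projT1 (cid (exists_turn x)).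
  have hn i : turn (iter i next e) (iter i.+1 next e).
    by rewrite iterS /next; case: cid.
  by exists (IPath hn).
move=> /andP[h /IH[p hp]].
have h0 : turn e (p 0%N) by case: hp => ->.
by exists (pcons h0); rewrite -[RHS]/(e :: (e' :: c)) -hp -prefix_pcons.
Qed.

(** A code of length [m.+2] is a code of length [m.+1] followed by a turn; [f] ignores the added
    edge, and finite additivity sums it out. *)
Lemma pairing_succ m f mu : FA mu -> inD m.+1 f ->
  pairing m.+2 f mu = pairing m.+1 f mu.
Proof.
move=> hmu hf; rewrite /pairing.
pose h (te : m.+1.-tuple (edge adj) * edge adj) : m.+2.-tuple (edge adj) :=
  [tuple of rcons te.1 te.2].
have h_bij : bijective h.
  apply: inj_card_bij; last by rewrite card_prod !card_tuple expnSr.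
  move=> [t e] [t' e'] /(congr1 val) /= /rcons_inj[E ->].
  by congr (_, _); exact: val_inj.
rewrite (reindex h) /=; last exact: onW_bij.
pose Q (t : m.+1.-tuple (edge adj)) e := turn (last e t) e.
rewrite (eq_bigl (fun te : m.+1.-tuple (edge adj) * edge adj => is_code te.1 && Q te.1 te.2)); last first.
  by case=> -[[|e0 t] //= ht] e; rewrite rcons_path.
rewrite -(pair_big_dep (fun t => is_code (tval t)) Q
  (fun t e => evalc f (rcons t e) * mu (rcons t e))) /=.
apply: eq_bigr => t ht.
have -> : mu t = \sum_(e | Q t e) mu (rcons t e).
  by case: t ht => -[|e0 t] //= st ht; rewrite hmu.
rewrite mulr_sumr; apply: eq_bigr => e hQ; congr (_ * _).
have : is_code (rcons t e).
  by move: hQ ht; rewrite /Q; case: t => -[|e0 t] //= st hQ ht; rewrite rcons_path ht.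
case/code_realized=> p; rewrite size_rcons size_tuple => hp.
have hp' : prefix (size t) p = t.
  by move: hp; rewrite prefixS size_tuple => /rcons_inj[].
rewrite (evalc_path _ hp') ?size_tuple // (evalc_path (p := p)) //.
  by rewrite size_rcons size_tuple; exact: inDW hf.
by rewrite size_rcons size_tuple.
Qed.

(* Trading [m] steps of the eigenvalue equation for [m] applications of [Top]
   leaves a function of the first edge only, of sup norm at most [q ^+ m * B]. *)
Lemma pairing_bound (z : C R) mu : symmetric adj -> z != 0 -> eig_FA z mu ->
  exists2 M : R, 0 <= M & forall m (B : R) f, 0 <= B -> supbound B f ->
    nrm (pairing m.+1 f mu) <= M * (q / nrm z) ^+ m * B.
Proof.
move=> adj_sym z0 hmu.
have nz : 0 < nrm z.
  rewrite lt_def nrm_ge0 andbT; apply: contra z0 => /eqP/nrm_eq0 ->; exact: eqxx.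
exists (\sum_(t : 1.-tuple (edge adj) | is_code t) nrm (mu t)).
  by apply: sumr_ge0 => t _; exact: nrm_ge0.
elim=> [|m IH] B f B0 hB.
  rewrite expr0 mulr1 mulr_suml; apply: le_trans (nrm_sum _ _) _.
  apply: ler_sum => t _.
  by rewrite nrmM mulrC ler_wpM2l ?nrm_ge0 // evalc_bound.
(* [pairing_Top] needs a cylinder function, which [f] need not be; [cylproj] has the same pairing
   and the same sup bound. *)
rewrite -pairing_cylproj; set g := cylproj _ f.
have gB : supbound B g by exact: cylproj_supbound.
have gD : inD m.+2 g by exact: cylproj_inD.
rewrite -(ler_pM2l nz) -nrmM -(pairing_Top hmu gD).
rewrite (pairing_succ hmu.1 (Top_inD gD)).
have qB : 0 <= q * B by rewrite mulr_ge0.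
apply: le_trans (IH _ _ qB (Top_supbound adj_sym B0 gB)) _.
rewrite exprS le_eqVlt; apply/orP; left; apply/eqP; field.
exact: lt0r_neq0.
Qed.

End Extension.

End TransferOperator.

(** * Restriction and extension of eigenfunctionals *)

Section EigenDistributions.
Context (R : realType) (V : finType) (adj : rel V).
Context (adj_sym : symmetric adj) (deg_ge2 : forall v : V, (2 <= deg adj v)%N).
Context (z : C R) (theta : R) (z_neq0 : z != 0).
Context (theta_gt0 : 0 < theta) (theta_lt1 : theta < 1).
Context (theta_lt : theta < nrm z / (qmax adj)%:R).
Implicit Types (f g : ipath adj -> C R) (c : seq (edge adj))
  (l : (ipath adj -> C R) -> C R) (mu : seq (edge adj) -> C R).

Local Notation prefix := Defs.prefix.
Local Notation q := ((qmax adj)%:R : R).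
Let r : R := q / nrm z * theta.

Let nrmz_gt0 : 0 < nrm z.
Proof.
rewrite lt_def nrm_ge0 andbT; apply: contra z_neq0 => /eqP/nrm_eq0 ->; exact: eqxx.
Qed.

Let theta_ge0 : 0 <= theta. Proof. exact: ltW. Qed.

Let r_ge0 : 0 <= r.
Proof. by rewrite mulr_ge0 ?divr_ge0 ?nrm_ge0. Qed.

Let r_lt1 : r < 1.
Proof.
(* For [q = 0] the quotient [nrm z / q] would be 0 by convention, contradicting [0 < theta]. *)
have q_gt0 : 0 < q.
  rewrite lt_def ler0n andbT; apply/eqP => q0.
  by have := lt_trans theta_gt0 theta_lt; rewrite q0 invr0 mulr0 ltxx.
move: theta_lt; rewrite /r mulrAC ltr_pdivlMr // => h.
by rewrite ltr_pdivrMr // mul1r mulrC.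
Qed.

Let exprr n : r ^+ n = (q / nrm z) ^+ n * theta ^+ n.
Proof. by rewrite exprMn. Qed.

Lemma Top_Lip f : Lip theta f -> Lip theta (Top f).
Proof.
case/(Lip_elim theta_gt0 theta_lt1) => B [L [B0 L0 hB hL]].
exact: Lip_intro (Top_supbound adj_sym B0 hB) (Top_lipbound adj_sym _ L0 hL).
Qed.

Lemma iter_Top_bounds n (B L : R) f : 0 <= B -> 0 <= L ->
  supbound B f -> lipbound theta L f ->
  supbound (q ^+ n * B) (iter n (@Top R V adj) f) /\
  lipbound theta ((q * theta) ^+ n * L) (iter n (@Top R V adj) f).
Proof.
move=> B0 L0 hB hL; elim: n => [|n [IH1 IH2]]; first by rewrite !expr0 !mul1r.
rewrite iterS !exprS -!mulrA; split.
  by apply: Top_supbound => //; rewrite mulr_ge0 ?exprn_ge0.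
rewrite mulrA; apply: Top_lipbound => //.
by rewrite mulr_ge0 ?exprn_ge0 ?mulr_ge0.
Qed.

Lemma iter_Top_Lip n f : Lip theta f -> Lip theta (iter n (@Top R V adj) f).
Proof. by move=> hf; elim: n => //= n; exact: Top_Lip. Qed.

Lemma eig_functional_iter n l f : eig_functional theta z l -> Lip theta f ->
  l (iter n (@Top R V adj) f) = z ^+ n * l f.
Proof.
move=> [_ _ hT] hf; elim: n => [|n IH]; first by rewrite expr0 mul1r.
by rewrite iterS hT ?IH ?exprS ?mulrA //; exact: iter_Top_Lip.
Qed.

(* Cylinder functions need not be dense in the Lipschitz norm, but the error
   [g = f - cylproj n.+1 f] satisfies [l g = l (z ^- n * Top^n g)], and the
   Lipschitz norm of [z ^- n * Top^n g] is at most [3 * L * r ^+ n]. *)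
Lemma eig_functional_approx l f (eps : R) : eig_functional theta z l ->
  Lip theta f -> 0 < eps -> exists N, forall n, (N <= n)%N ->
  nrm (l f - pairing n.+1 f (fun c => l (ind R c))) < eps.
Proof.
move=> hl hf eps0; have [hlin hcont _] := hl.
have h0 : Lip theta (fun _ : ipath adj => 0 : C R) by apply: (@inD_Lip _ _ _ _ 0).
have l0 := lin_on_Lip0 theta_gt0 theta_lt1 hlin.
have [d d0 hd] := hcont _ h0 _ eps0.
have [B [L [B0 L0 hB hL]]] := Lip_elim theta_gt0 theta_lt1 hf.
have K0 : 0 < 3 * L + 1 by move: L0; lra.
have [N hN] := expr_small r_ge0 r_lt1 (divr_gt0 d0 K0).
exists N => n /hN; rewrite ltr_pdivlMr // => hn.
pose g := fun p => -1 * cylproj n.+1 f p + f p.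
have projLip : Lip theta (cylproj n.+1 f) by exact: inD_Lip (@cylproj_inD _ _ _ _ _).
have gLip : Lip theta g by exact: Lip_lin.
have -> : l f - pairing n.+1 f (fun c => l (ind R c)) = l g.
  rewrite /g hlin // mulN1r addrC; congr (- _ + _).
  rewrite -pairing_cylproj; apply/esym.
  apply: (lin_on_Lip_inD theta_gt0 theta_lt1 hlin); exact: cylproj_inD.
(* One factor [theta] is given away so that the exponent matches the [n] applications of [Top]. *)
have gB : supbound (L * theta ^+ n) g.
  move=> p; apply: le_trans (cylproj_dist _ hL p) _ => //.
  by rewrite ler_wpM2l // exprS ler_piMl ?exprn_ge0 // ltW.
have gL : lipbound theta (nrm (-1 : C R) * L + L) g.
  apply: lipbound_lin => //; exact: cylproj_lipbound.
rewrite nrmN nrm1 mul1r in gL.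
have [TB TL] := iter_Top_bounds n (mulr_ge0 L0 (exprn_ge0 n theta_ge0))
  (addr_ge0 L0 L0) gB gL.
have TLip := iter_Top_Lip n gLip.
pose h := fun p => (z ^- n) * iter n (@Top R V adj) g p + 0.
have hLip : Lip theta h by exact: Lip_lin.
(* Continuity is applied at the zero function, so its image is kept as an explicit subtrahend. *)
have -> : l g = l h - l (fun=> 0).
  rewrite /h (hlin _ _ _ TLip h0) l0 addr0 subr0 (eig_functional_iter n hl gLip).
  by rewrite mulKf // expf_neq0.
apply: hd => //.
have -> : (fun p => h p - 0) = h by apply: funext => p; rewrite subr0.
have zB : supbound (nrm (z ^- n) * (q ^+ n * (L * theta ^+ n)) + 0) h.
  by apply: supbound_lin => // p; rewrite nrm0.
have zL : lipbound theta (nrm (z ^- n) * ((q * theta) ^+ n * (L + L)) + 0) h.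
  by apply: lipbound_lin => // k p p' _ _; rewrite subrr nrm0 mul0r.
rewrite nrmV nrmX in zB zL.
have eB : (nrm z ^+ n)^-1 * (q ^+ n * (L * theta ^+ n)) + 0 = L * r ^+ n.
  rewrite exprr exprMn exprVn addr0; ring.
have eL : (nrm z ^+ n)^-1 * ((q * theta) ^+ n * (L + L)) + 0 = (L + L) * r ^+ n.
  rewrite exprr !exprMn exprVn addr0; ring.
rewrite eB in zB; rewrite eL in zL.
apply: le_lt_trans (lipnorm_le theta_gt0 _ _ zB zL) _.
- by rewrite mulr_ge0 ?exprn_ge0.
- by rewrite mulr_ge0 ?exprn_ge0 ?addr_ge0.
apply: le_lt_trans hn.
by have := exprn_ge0 n r_ge0; move: (r ^+ n) => t; lra.
Qed.

(** Both values are limits of one and the same sequence of pairings; at a common depth each would be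
    closer to it than half their distance. *)
Lemma eig_functional_inj l1 l2 : eig_functional theta z l1 ->
  eig_functional theta z l2 ->
  (forall c, is_code c -> l1 (ind R c) = l2 (ind R c)) ->
  forall f, Lip theta f -> l1 f = l2 f.
Proof.
move=> h1 h2 E f hf; apply/eqP; rewrite -subr_eq0; apply/negPn/negP => ne.
have d0 : 0 < nrm (l1 f - l2 f).
  rewrite lt_def nrm_ge0 andbT; apply: contra ne => /eqP/nrm_eq0 ->; exact: eqxx.
have [N1 hN1] := eig_functional_approx h1 hf (divr_gt0 d0 (ltr0Sn R 1)).
have [N2 hN2] := eig_functional_approx h2 hf (divr_gt0 d0 (ltr0Sn R 1)).
have := hN1 _ (leq_maxl N1 N2); have := hN2 _ (leq_maxr N1 N2).
set n := maxn N1 N2.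
have -> : pairing n.+1 f (fun c => l2 (ind R c)) = pairing n.+1 f (fun c => l1 (ind R c)).
  by apply: eq_bigr => t ht; rewrite E.
set w := pairing _ _ _; rewrite (nrm_distC (l2 f)).
have := nrm_sub_triangle w (l1 f) (l2 f).
by set a := nrm (l1 f - w); set b := nrm (w - l2 f); lra.
Qed.

(** A cylinder is the disjoint union of its one-edge refinements; applying a linear functional turns
    this into finite additivity. The factor 1 fits [lin_on_Lip_sum]. *)
Lemma ind_split (e : edge adj) c : path (@turn V adj) e c -> ind R (e :: c) =
  (fun p => \sum_(e' | turn (last e c) e') 1 * ind R (rcons (e :: c) e') p).
Proof.
move=> hc; apply: funext => p; rewrite /ind.
have -> : prefix (size (e :: c)) p = prefix (size c).+1 p by [].
under eq_bigr => e' _ do rewrite mul1r size_rcons prefixS eqseq_rcons.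
have [E|_] := eqP; last by rewrite big1.
have ht : turn (last e c) (p (size c).+1).
  have -> : last e c = p (size c); last exact: pturn.
  by rewrite -[LHS]/(last e (e :: c)) -E prefixS last_rcons.
rewrite (bigD1 _ ht) /= eqxx big1 ?addr0 // => e' /andP[_ ne].
by rewrite eq_sym (negbTE ne).
Qed.

Lemma eig_functional_restrict l : eig_functional theta z l ->
  eig_FA z (fun c => l (ind R c)) /\ extends l (fun c => l (ind R c)).
Proof.
move=> [hlin _ hT].
have ext : extends l (fun c => l (ind R c)).
  by move=> [|m] f // _; exact: lin_on_Lip_inD hlin.
split=> //; split=> [e c hc|[|e c] // hc].
  rewrite [in LHS](ind_split hc).
  rewrite (proj2 (lin_on_Lip_sum _ _ _ theta_gt0 theta_lt1 hlin _)).
    by apply: eq_bigr => e' _; rewrite mul1r.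
  by move=> e'; exact: ind_Lip.
(* The pairing at depth [size c] is the value of [l] once [Top (ind R c)] is known to have that
   depth; [ind R c] is first regarded as one edge deeper, since [Top_inD] lowers the depth by
   one. *)
rewrite /Tdual -ext //; first by apply: hT; exact: ind_Lip.
by apply: Top_inD; apply: inDW (@ind_inD _ _ _ _); exact: leqnSn.
Qed.

(** * Extension of an eigen-[mu] by limits of pairings *)

Section Extension.
Context (mu : seq (edge adj) -> C R) (hmu : eig_FA z mu) (M : R) (M_ge0 : 0 <= M).
Context (hM : forall m (B : R) f, 0 <= B -> supbound B f ->
    nrm (pairing m.+1 f mu) <= M * (q / nrm z) ^+ m * B).

(** Convergence at rate [r] with a free constant; in this form limits are unique and pass through
    linear combinations and [Top]. *)
Definition pairing_lim f (x : C R) :=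
  exists K : R, forall n, nrm (x - pairing n.+1 f mu) <= K * r ^+ n.

Lemma pairing_lim_unique f x y : pairing_lim f x -> pairing_lim f y -> x = y.
Proof.
move=> [K hK] [K' hK']; apply/eqP; rewrite -subr_eq0; apply/eqP.
apply: (geometric_eq0 r_ge0 r_lt1 (K := K + K') (N := 0)) => n _.
apply: le_trans (nrm_sub_triangle (pairing n.+1 f mu) _ _) _.
by rewrite mulrDl lerD // nrm_distC.
Qed.

(** Lifted to depth [n.+2], the difference is the pairing of [f - cylproj n.+1 f], whose sup norm
    [L * theta ^+ n.+1] outweighs the growth [(q / nrm z) ^+ n.+1]. *)
Lemma pairing_step n (L : R) f : 0 <= L -> lipbound theta L f ->
  nrm (pairing n.+2 f mu - pairing n.+1 f mu) <= M * L * r ^+ n.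
Proof.
move=> L0 hL.
rewrite -[pairing n.+1 f mu]pairing_cylproj.
rewrite -(pairing_succ deg_ge2 hmu.1 (@cylproj_inD _ _ _ _ _)).
rewrite addrC -mulN1r -pairing_lin.
apply: le_trans (hM n.+1 _ (cylproj_dist _ hL)) _ => //.
  by rewrite mulr_ge0 ?exprn_ge0.
have -> : M * (q / nrm z) ^+ n.+1 * (L * theta ^+ n.+1) = M * L * r ^+ n.+1.
  by rewrite exprr; ring.
by rewrite ler_wpM2l ?mulr_ge0 // exprS ler_piMl ?exprn_ge0 // ltW.
Qed.

(** The bound on [x], from the depth-one pairing plus the geometric tail, is what makes the
    extension continuous. *)
Lemma pairing_lim_exists (B L : R) f : 0 <= B -> 0 <= L -> supbound B f ->
  lipbound theta L f -> exists2 x, pairing_lim f x &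
  nrm x <= M * B + 2 * (M * L / (1 - r)).
Proof.
move=> B0 L0 hB hL.
have [x hx] := geometric_cauchy r_ge0 r_lt1 (fun n => pairing_step n L0 hL).
exists x; first by exists (2 * (M * L / (1 - r))).
have := hx 0%N; have := hM 0 B0 hB; have := nrm_triangle (x - pairing 1 f mu) (pairing 1 f mu).
by rewrite subrK !expr0 !mulr1; lra.
Qed.

Lemma pairing_lim_lin (a : C R) f g x y : pairing_lim f x -> pairing_lim g y ->
  pairing_lim (fun p => a * f p + g p) (a * x + y).
Proof.
move=> [K hK] [K' hK']; exists (nrm a * K + K') => n.
rewrite pairing_lin.
have -> : a * x + y - (a * pairing n.+1 f mu + pairing n.+1 g mu) =
  a * (x - pairing n.+1 f mu) + (y - pairing n.+1 g mu) by ring.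
apply: le_trans (nrm_triangle _ _) _.
by rewrite nrmM mulrDl -mulrA lerD ?ler_wpM2l ?nrm_ge0.
Qed.

(** The eigenvalue equation is exact on [cylproj n.+2 f]; the remainder is [Top] of the
    approximation error, paired at depth [n.+1]. *)
Lemma pairing_lim_Top f x : Lip theta f -> pairing_lim f x ->
  pairing_lim (Top f) (z * x).
Proof.
move=> /(Lip_elim theta_gt0 theta_lt1)[B [L [_ L0 _ hL]]] [K hK].
exists (nrm z * (K * r) + M * (q * (L * (theta * theta)))) => n.
apply: le_trans (nrm_sub_triangle (z * pairing n.+2 f mu) _ _) _.
rewrite mulrDl lerD //.
  have -> : nrm z * (K * r) * r ^+ n = nrm z * (K * r ^+ n.+1) by rewrite exprS; ring.
  by rewrite -mulrBr nrmM ler_wpM2l ?nrm_ge0.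
rewrite -[pairing n.+2 f mu]pairing_cylproj.
rewrite -(pairing_Top hmu); last exact: cylproj_inD.
rewrite (pairing_succ deg_ge2 hmu.1); last by apply: Top_inD; exact: cylproj_inD.
rewrite nrm_distC addrC -mulN1r -pairing_lin -Top_lin.
have dist : supbound (L * theta ^+ n.+2) (fun p => -1 * cylproj n.+2 f p + f p).
  exact: cylproj_dist.
have D0 : 0 <= L * theta ^+ n.+2 by rewrite mulr_ge0 ?exprn_ge0.
apply: le_trans (hM n (mulr_ge0 (ler0n R (qmax adj)) D0) (Top_supbound adj_sym D0 dist)) _.
by rewrite exprr !exprS le_eqVlt; apply/orP; left; apply/eqP; ring.
Qed.

Lemma pairing_lim_inD m f : (0 < m)%N -> inD m f -> pairing_lim f (pairing m f mu).
Proof.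
case: m => // m _ hf.
have [B [L [B0 L0 hB hL]]] := Lip_elim theta_gt0 theta_lt1 (inD_Lip theta_gt0 theta_lt1 hf).
have [x hx _] := pairing_lim_exists B0 L0 hB hL.
(* The pairings are constant only from depth [m.+1] on; the existing limit [x] supplies a constant
   that also covers the earlier terms. *)
suff -> : pairing m.+1 f mu = x by [].
have [K hK] := hx; apply/esym/eqP; rewrite -subr_eq0; apply/eqP.
apply: (geometric_eq0 r_ge0 r_lt1 (K := K) (N := m)) => n le_mn.
suff <- : pairing n.+1 f mu = pairing m.+1 f mu by [].
elim: n le_mn => [|n IH]; first by rewrite leqn0 => /eqP ->.
rewrite leq_eqVlt => /orP[/eqP -> //|le_mn].
by rewrite (pairing_succ deg_ge2 hmu.1) ?IH //; exact: inDW hf.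
Qed.

Lemma eig_FA_extend : exists l, eig_functional theta z l /\ extends l mu.
Proof.
(* The default 0 is taken only where no limit exists, hence never on Lipschitz functions. *)
pose l f := xget 0 [set x | pairing_lim f x]%classic.
have hl f : Lip theta f -> pairing_lim f (l f).
  case/(Lip_elim theta_gt0 theta_lt1) => B [L [B0 L0 hB hL]].
  have [x hx _] := pairing_lim_exists B0 L0 hB hL.
  exact: (@xgetPex _ 0 [set x | pairing_lim f x]%classic (ex_intro _ x hx)).
have lin : lin_on_Lip theta l.
  move=> a f g hf hg; apply: (pairing_lim_unique (hl _ _)); first exact: Lip_lin.
  exact: pairing_lim_lin (hl _ hf) (hl _ hg).
exists l; split; last first.
  move=> m f m0 hf; apply: pairing_lim_unique (pairing_lim_inD m0 hf).
  by apply: hl; exact: inD_Lip hf.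
split=> //.
- move=> f hf eps eps0.
  (* With [B] and [L] the two parts of the Lipschitz norm, the bound of [pairing_lim_exists] is at
     most [K] times that norm; [K + 1] ensures a positive divisor. *)
  pose K := M + 2 * (M / (1 - r)).
  have K0 : 0 <= K by rewrite addr_ge0 // mulr_ge0 // divr_ge0 // subr_ge0 ltW.
  have K1 : 0 < K + 1 by rewrite ltr_wpDl.
  exists (eps / (K + 1)) => [|g hg]; first exact: divr_gt0.
  rewrite ltr_pdivlMr //.
  have -> : (fun p => g p - f p) = (fun p => -1 * f p + g p).
    by apply: funext => p; rewrite mulN1r addrC.
  have -> : l g - l f = l (fun p => -1 * f p + g p) by rewrite lin // mulN1r addrC.
  have dLip := Lip_lin theta_gt0 theta_lt1 (-1) hf hg.
  set d := (fun p => _) in dLip *; rewrite /lipnorm => hd.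
  have dB := supnorm_bound dLip.1.
  have dL := L1_bound theta_gt0 theta_lt1 dLip.
  have L0 := L1_ge0 theta_gt0 theta_lt1 dLip.
  have B0 : 0 <= supnorm d.
    rewrite /supnorm; set E := (X in sup X).
    have [->|/set0P[_ [p _ _]]] := eqVneq E set0; first by rewrite sup0.
    exact: le_trans (nrm_ge0 _) (dB p).
  have [x hx] := pairing_lim_exists B0 L0 dB dL.
  rewrite (pairing_lim_unique (hl _ dLip) hx) => hx'.
  apply: le_lt_trans hx' _; apply: le_lt_trans hd.
  have -> : M * L1 theta d / (1 - r) = M / (1 - r) * L1 theta d by rewrite mulrAC.
  have P0 : 0 <= M / (1 - r) by rewrite divr_ge0 // subr_ge0 ltW.
  rewrite /K; move: (M / (1 - r)) P0 => P P0.
  by move: M_ge0 B0 L0; nra.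
- move=> f hf; apply: pairing_lim_unique (pairing_lim_Top hf (hl _ hf)).
  by apply: hl; exact: Top_Lip.
Qed.

End Extension.

End EigenDistributions.

Theorem mainTheorem15 (R : realType) (V : finType) (adj : rel V)
  (adj_irr : irreflexive adj) (adj_sym : symmetric adj)
  (adj_conn : forall x y : V, connect adj x y)
  (deg_ge2 : forall v : V, (2 <= deg adj v)%N)
  (z : C R) (theta : R)
  (z_neq0 : z != 0) (theta_gt0 : 0 < theta) (theta_lt1 : theta < 1)
  (theta_lt : theta < nrm z / (qmax adj)%:R) :
  [/\ (* restriction l |-> (c |-> l(1_c)) maps into {mu in FA : T' mu = z mu},
         and l agrees with the pairing against this mu on D_infinity *)
      forall l : (ipath adj -> C R) -> C R, eig_functional theta z l ->
        eig_FA z (fun c : seq (edge adj) => l (ind R c)) /\ extends l (fun c : seq (edge adj) => l (ind R c)),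
      (* injectivity *)
      forall l1 l2 : (ipath adj -> C R) -> C R, eig_functional theta z l1 -> eig_functional theta z l2 ->
        (forall c : seq (edge adj), is_code c -> l1 (ind R c) = l2 (ind R c)) ->
        forall f : ipath adj -> C R, Lip theta f -> l1 f = l2 f
    & (* surjectivity: every eigen-mu extends to a continuous eigenfunctional *)
      forall mu : seq (edge adj) -> C R, eig_FA z mu ->
        exists l : (ipath adj -> C R) -> C R, eig_functional theta z l /\ extends l mu].
Proof.
split.
- by move=> l; exact: eig_functional_restrict.
- by move=> l1 l2; exact: (eig_functional_inj adj_sym z_neq0 theta_gt0 theta_lt1 theta_lt).
- move=> mu hmu.
  have [M M_ge0 hM] := pairing_bound deg_ge2 adj_sym z_neq0 hmu.
  exact: (eig_FA_extend adj_sym deg_ge2 z_neq0 theta_gt0 theta_lt1 theta_lt hmu M_ge0 hM).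
Qed.
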